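(* Let $\widehat{A}=A+\varepsilon B$ be an $n\times n$ dual matrix with $A,B\in\mathbb{R}^{n\times n}$. Then the dual index of $\widehat{A}$ is one if and only if the dual group generalized inverse $\widehat{A}^{\#}$ exists.
   Context: Dual numbers are $a+\varepsilon a'$ with $a,a'\in\mathbb{R}$ and $\varepsilon\neq 0$, $\varepsilon^2=0$ (i.e. the ring $\mathbb{R}[\varepsilon]/(\varepsilon^2)$). A dual matrix is a matrix over dual numbers, written $\widehat{A}=A+\varepsilon B$ with $A,B$ real. The range $\mathcal{R}(\widehat{A})$ of an $n\times n$ dual matrix is $\{\widehat{A}\widehat{x}: \widehat{x}$ a dual column vector of length $n\}$. The dual index of an $n\times n$ dual matrix $\widehat{A}$ is said to be equal to one if $\mathcal{R}(\widehat{A}^2)=\mathcal{R}(\widehat{A})$. The dual group generalized inverse (DGGI) $\widehat{A}^{\#}$ of $\widehat{A}$ is an $n\times n$ dual matrix $\widehat{G}$ with $\widehat{A}\widehat{G}\widehat{A}=\widehat{A}$, $\widehat{G}\widehat{A}\widehat{G}=\widehat{G}$, $\widehat{A}\widehat{G}=\widehat{G}\widehat{A}$; it may or may not exist. *)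

(* Defs.v *)
From HB Require Import structures.
From mathcomp Require Import all_boot all_order all_algebra.
From mathcomp Require Import qpoly.
From mathcomp Require Import all_classical all_reals.

Set Implicit Arguments.
Unset Strict Implicit.
Unset Printing Implicit Defensive.

Import Order.TTheory GRing.Theory Num.Theory.
Local Open Scope classical_set_scope.
Local Open Scope ring_scope.

(* The dual numbers R[eps]/(eps^2). The library quotient {poly %/ p} is by p
   itself only when p is monic of size > 1, which holds for 'X^2. *)
Notation dual R := {poly %/ ('X^2 : {poly R})}.

Section DualNumbers.
Variable R : realType.

Definition eps : dual R := qpolyX 'X^2.

Definition todual : R -> dual R := qpolyC 'X^2.

Lemma polyn_eps : eps = 'X :> {poly R}.
Proof. by rewrite /eps qpolyXE ?size_polyXn ?monicXn. Qed.

Lemma eps_neq0 : eps != 0.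
Proof.
apply/eqP => /(congr1 (fun p : dual R => (p : {poly R}))).
by rewrite polyn_eps => /eqP; rewrite polyX_eq0.
Qed.

Lemma eps_sqr : eps ^+ 2 = 0.
Proof.
apply/val_inj; rewrite [LHS]poly_of_qpolyX polyn_eps -[RHS]/(0 : {poly R}).
by rewrite mk_monic_Xn Pdiv.RingMonic.rmodpp ?monicXn.
Qed.

Lemma dualE (z : dual R) :
  z = todual (z : {poly R})`_0 + eps * todual (z : {poly R})`_1.
Proof.
have scE (a : R) : eps * todual a = a *: eps.
  rewrite mulrC; apply/val_inj; rewrite [LHS]poly_of_qpolyM [RHS]poly_of_qpolyZ.
  rewrite polyn_eps [todual a : {poly R}]qpolyCE mul_polyC mk_monic_Xn.
  rewrite Pdiv.CommonRing.rmodp_small ?monicXn // size_polyXn.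
  by rewrite (leq_ltn_trans (size_scale_leq _ _)) // size_polyX.
rewrite scE; apply/val_inj.
rewrite [RHS]poly_of_qpolyD poly_of_qpolyZ polyn_eps qpolyCE.
apply/polyP => i; rewrite coefD coefC coefZ coefX.
case: i => [|[|i]] /=; rewrite ?mulr0 ?mulr1 ?addr0 ?add0r //.
have szz : (size (z : {poly R}) < 3)%N.
  apply: leq_trans (size_mk_monic z) _.
  by rewrite mk_monic_Xn size_polyXn.
by apply: nth_default; rewrite (leq_trans (_ : _ <= 2)%N).
Qed.

Definition dual_mx m n (A B : 'M[R]_(m, n)) : 'M[dual R]_(m, n) :=
  map_mx todual A + eps *: map_mx todual B.

Definition drange n (M : 'M[dual R]_n) : set 'cV[dual R]_n :=
  [set M *m x | x in [set: 'cV[dual R]_n]].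

(* Under this definition invertible matrices also have index one. *)
Definition dual_index_one n (M : 'M[dual R]_n) : Prop :=
  drange (M *m M) = drange M.

Definition is_DGGI n (M G : 'M[dual R]_n) : Prop :=
  [/\ M *m G *m M = M, G *m M *m G = G & M *m G = G *m M].

End DualNumbers.

(* Main.v *)
(** Cayley-Hamilton gives a monic p over the dual numbers with p(M) = 0.
    Write p = P + eps S with P, S real: then P^2 = p (P - eps S) also annihilates M,
    so M is a root of a nonzero real polynomial, and cancelling the lowest
    coefficient yields M^k = M^(k+1) Q with Q a polynomial in M.
    If the ranges of M^2 and M agree then M = M^2 X for some X; multiplying the
    former relation by powers of X gives M = Q M^2, and Q M X is then the
    group inverse. *)

Require Import Defs.
From mathcomp Require Import all_boot all_order all_algebra.
From mathcomp Require Import qpoly.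
From mathcomp Require Import all_classical all_reals.

Set Implicit Arguments.
Unset Strict Implicit.
Unset Printing Implicit Defensive.

Import GRing.Theory.
Local Open Scope ring_scope.

(** Both [a * x] and [y * a] equal [y * a * a * x]. With [g = y * a * x], the products [a * g] and
    [g * a] then both collapse to this common element. *)
Lemma group_inverse_of_factorizations (S : pzRingType) (a x y : S) :
    a = a * a * x -> a = y * a * a ->
  exists g, [/\ a * g * a = a, g * a * g = g & a * g = g * a].
Proof.
move=> ax ya.
have axya : a * x = y * a by rewrite {1}ya -!mulrA [a * (a * x)]mulrA -ax.
have axa : a * x * a = a by rewrite axya -ya.
have ag : a * (y * a * x) = a * x by rewrite -axya -!mulrA !mulrA -ax.
have ga : y * a * x * a = a * x by rewrite -mulrA -[y * a * _]mulrA [a * (x * a)]mulrA axa axya.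
exists (y * a * x); split; first by rewrite ag.
  by rewrite ga -axya !mulrA axa.
by rewrite ag ga.
Qed.

(** Although [x] need not commute with [a], right multiplication by [x ^+ k] still lowers
    [a ^+ k.+1] to [a]. *)
Lemma left_factorization_of_pi_regular (S : pzRingType) (a x q : S) (k : nat) :
    a = a * a * x -> GRing.comm a q -> a ^+ k = a ^+ k.+1 * q ->
  a = q * a * a.
Proof.
move=> ax aq ak.
have aE i : a ^+ i.+1 * x ^+ i = a.
  elim: i => [|i IHi]; first by rewrite mulr1.
  have -> : a ^+ i.+2 * x ^+ i.+1 = a ^+ i * (a * a * x) * x ^+ i.
    by rewrite 2!exprSr exprS !mulrA.
  by rewrite -ax -exprSr.
have ak1 : a ^+ k.+1 = q * a * a ^+ k.+1.
  by rewrite -mulrA -exprS (commrX _ (commr_sym aq)) exprS -mulrA -ak -exprS.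
by rewrite -[in LHS](aE k) ak1 -mulrA aE.
Qed.

(** Here [k] is the multiplicity of the root 0. The minus sign makes a relation p(M) = 0 read c M^k
    = M^(k+1) q(M). *)
Lemma poly_lowest_term (F : fieldType) (p : {poly F}) :
  p != 0 -> exists k c q, c != 0 /\ p = 'X^k * (c%:P - 'X * q).
Proof.
move=> p0; have [k [q]] := multiplicity_XsubC p 0.
rewrite p0 /= subr0 => q0 ->.
have /factor_theorem[r] : root (q - q.[0]%:P) 0 by rewrite rootE !hornerE subrr.
rewrite subr0 => /(canRL (subrK _)) qE.
exists k, q.[0], (- r); split; first exact: q0.
by rewrite {1}qE mulrN opprK mulrC [r * _]mulrC addrC.
Qed.

Section DualMatrices.
Variable R : realType.
Implicit Types (n : nat).

Lemma todualK (a : R) : (todual a : {poly R})`_0 = a.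
Proof. by rewrite /todual qpolyCE coefC. Qed.

(** Passing to real coefficients makes the lowest nonzero one invertible; over the dual numbers it
    could be a multiple of [eps]. *)
Lemma dual_poly_real_multiple (p : {poly dual R}) : p \is monic ->
  exists2 P : {poly R}, P != 0 & exists s, map_poly (@todual R) P = p * s.
Proof.
move=> pm.
pose re := \poly_(i < size p) (p`_i : {poly R})`_0.
pose im := \poly_(i < size p) (p`_i : {poly R})`_1.
have todual0 : todual (0 : R) = 0 := raddf0 (qpolyC ('X^2 : {poly R})).
have pE : p = map_poly (@todual R) re + (eps R)%:P * map_poly (@todual R) im.
  apply/polyP => i; rewrite coefD coefCM !coef_map_id0 // !coef_poly.
  case: ltnP => [_|ip]; first exact: dualE.
  by rewrite todual0 mulr0 addr0 nth_default.
exists (re * re).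
  suff re0 : re != 0 by rewrite mulf_neq0.
  (* The leading coefficient 1 of [p] has real part 1. *)
  have : re`_(size p).-1 != 0.
    rewrite coef_poly ltn_predL size_poly_gt0 monic_neq0 // -lead_coefE.
    by rewrite (monicP pm) -[1]/(todual 1) todualK oner_eq0.
  by apply: contraNneq => ->; rewrite coef0.
exists (map_poly (@todual R) re - (eps R)%:P * map_poly (@todual R) im).
rewrite [in RHS]pE [RHS]mulrC -subr_sqr exprMn -polyC_exp eps_sqr mul0r subr0.
exact: (rmorphM (map_poly (qpolyC ('X^2 : {poly R})))).
Qed.

Lemma dual_mx_pi_regular n (M : 'M[dual R]_n.+1) :
  exists k Q, GRing.comm M Q /\ M ^+ k = M ^+ k.+1 * Q.
Proof.
have [P P0 [s Ps]] := dual_poly_real_multiple (char_poly_monic M).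
have [k [c [q [c0 PE]]]] := poly_lowest_term P0.
pose phi : {rmorphism {poly R} -> 'M[dual R]_n.+1} :=
  horner_mx M \o map_poly (qpolyC ('X^2 : {poly R})).
have phiX : phi 'X = M by rewrite /= map_polyX horner_mx_X.
have phiP : phi P = 0.
  rewrite /= -[map_poly _ P]/(map_poly (@todual R) P) Ps rmorphM /=.
  by rewrite Cayley_Hamilton mul0r.
exists k, (phi (c^-1%:P * q)); split.
  by rewrite /GRing.comm -[in LHS]phiX -[in RHS]phiX -!rmorphM mulrC.
apply/eqP; rewrite -subr_eq0 -phiX -!rmorphXn -rmorphM -rmorphB.
have -> : 'X^k - 'X^(k.+1) * (c^-1%:P * q) = c^-1%:P * P.
  rewrite PE [RHS]mulrCA [c^-1%:P * (_ - _)]mulrBr -polyCM mulVf //.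
  by rewrite mulrBr mulr1 exprSr -mulrA ['X * (c^-1%:P * q)]mulrCA.
by rewrite rmorphM phiP mulr0.
Qed.

(** Columns of [M] are images of basis vectors; chosen preimages under [N] form the columns of
    [X]. *)
Lemma drange_factor n (M N : 'M[dual R]_n) :
  (drange M `<=` drange N)%classic -> exists X, M = N *m X.
Proof.
move=> MN.
have /choice[f fE] j : exists x, N *m x = col j M.
  have [|x _ <-] := MN (col j M); last by exists x.
  by exists (delta_mx j 0); rewrite // colE.
exists (\matrix_(i, j) f j i 0); apply/matrixP => i j.
have := congr1 (fun v : 'cV_n => v i 0) (fE j); rewrite !mxE => <-.
by apply: eq_bigr => l _; rewrite mxE.
Qed.

Lemma drange_mul_sub n (M X : 'M[dual R]_n) :
  (drange (M *m X) `<=` drange M)%classic.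
Proof. by move=> _ [x _ <-]; exists (X *m x); rewrite ?mulmxA. Qed.

End DualMatrices.

Theorem theorem2p6 (R : realType) (n : nat) (A B : 'M[R]_n) :
  dual_index_one (dual_mx A B) <->
  exists G : 'M[dual R]_n, is_DGGI (dual_mx A B) G.
Proof.
move: (dual_mx A B) => M {A B}; split.
  case: n M => [|n] M idx1.
    by exists 0; split; apply/matrixP => -[].
  have [|X MX] := @drange_factor R _ M (M *m M); first by rewrite idx1.
  have [k [Q [MQ Mk]]] := dual_mx_pi_regular M.
  exact: group_inverse_of_factorizations MX
    (left_factorization_of_pi_regular MX MQ Mk).
case=> G [MGM _ MG]; apply/seteqP; split; first exact: drange_mul_sub.
(* Only the [M] of the smaller range is rewritten, as M^2 G. *)
have {1}<- : M *m M *m G = M by rewrite -mulmxA MG mulmxA.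
exact: drange_mul_sub.
Qed.
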